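(* Let $T>0$, let $B=\{B_t\}_{t\in[0,T]}$ be a fractional Brownian motion with Hurst parameter $H>\frac12$ (so $H\in(\frac12,1)$), and let $M_t:=\max_{0\le s\le t}B_s$ for $t\in[0,T]$. Then the representation $$M_T=B_0+\int_0^T\mathbf{1}_{\{B_t=M_t\}}\,dB_t$$ does not hold, where the integral on the right-hand side is understood pathwise as a generalized Lebesgue--Stieltjes integral. That is, it is not the case that this identity holds almost surely.
   Context: A fractional Brownian motion with Hurst index $H\in(0,1)$ is a continuous centered Gaussian process $B$ with $B_0=0$ and covariance $\mathbb{E}(B_sB_t)=\frac12\left(t^{2H}+s^{2H}-|t-s|^{2H}\right)$. For $0<\beta<1$: (i) $W^{\beta}_1([0,T])$ is the space of measurable $f:[0,T]\to\mathbb{R}$ with $$\Vert f\Vert_{1,\beta}:=\sup_{0\le s<t\le T}\left(\frac{|f(t)-f(s)|}{(t-s)^{\beta}}+\int_s^t\frac{|f(u)-f(s)|}{(u-s)^{1+\beta}}\,du\right)<\infty.$$ (ii) $W^{\beta}_2([0,T])$ is the space of measurable $f:[0,T]\to\mathbb{R}$ with $$\Vert f\Vert_{2,\beta}:=\int_0^T\frac{|f(s)|}{s^{\beta}}\,ds+\int_0^T\int_0^s\frac{|f(u)-f(s)|}{(s-u)^{1+\beta}}\,du\,ds<\infty.$$ The Weyl fractional derivatives of order $\beta\in(0,1)$ are $$(D^{\beta}_{0+}f)(x)=\frac{1}{\Gamma(1-\beta)}\left(\frac{f(x)}{x^{\beta}}+\beta\int_0^x\frac{f(x)-f(y)}{(x-y)^{\beta+1}}\,dy\right)\mathbf{1}_{(0,T)}(x),$$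 $$(D^{\beta}_{T-}f)(x)=\frac{1}{\Gamma(1-\beta)}\left(\frac{f(x)}{(T-x)^{\beta}}+\beta\int_x^T\frac{f(x)-f(y)}{(y-x)^{\beta+1}}\,dy\right)\mathbf{1}_{(0,T)}(x).$$ If $f\in W^{\beta}_2([0,T])$ and $g\in W^{1-\beta}_1([0,T])$ for some $\beta\in(0,1)$, the generalized Lebesgue--Stieltjes integral of $f$ with respect to $g$ is defined by the (existing) Lebesgue integral $$\int_0^T f\,dg:=\int_0^T(D^{\beta}_{0+}f)(x)\,(D^{1-\beta}_{T-}g_{T-})(x)\,dx,\qquad g_{T-}(x):=(g(T-)-g(x))\mathbf{1}_{(0,T)}(x).$$ In the claim this is applied for each fixed sample path, with $f(t)=\mathbf{1}_{\{B_t=M_t\}}$ and $g(t)=B_t$. *)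

(* Defs.v *)
From HB Require Import structures.
From mathcomp Require Import all_boot all_order all_algebra.
From mathcomp Require Import all_classical all_reals all_analysis.

Set Implicit Arguments.
Unset Strict Implicit.
Unset Printing Implicit Defensive.

Import Order.TTheory GRing.Theory Num.Theory.
Import numFieldNormedType.Exports.

Local Open Scope classical_set_scope.
Local Open Scope ring_scope.

(* Point masses count as Gaussian laws (a process with B_0 = 0 needs them). The
   case s = 0 is separate because [normal_prob m 0] is uniform on [0, 1]. *)
Definition gaussian_rv (d : measure_display) (Omega : measurableType d)
    (R : realType) (P : probability Omega R) (X : Omega -> R) : Prop :=
  exists m s : R, 0 <= s /\
    forall A : set R, measurable A ->
      P (X @^-1` A) = if s == 0 then \d_m A else normal_prob m s A.

(* The index set is [0, T]; the values of B at other times are irrelevant. *)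
Definition gaussian_process (d : measure_display) (Omega : measurableType d)
    (R : realType) (P : probability Omega R) (T : R)
    (B : R -> {RV P >-> R}) : Prop :=
  forall (n : nat) (t c : 'I_n -> R), (forall i, t i \in `[0, T]) ->
    gaussian_rv P (fun w => \sum_(i < n) c i * B (t i) w).

Definition path_of (d : measure_display) (Omega : measurableType d)
    (R : realType) (P : probability Omega R)
    (B : R -> {RV P >-> R}) (w : Omega) : R -> R := fun t => B t w.

Record fractional_brownian_motion (d : measure_display)
    (Omega : measurableType d) (R : realType) (P : probability Omega R)
    (T H : R) (B : R -> {RV P >-> R}) : Prop := {
  fbm_continuous : forall w, {within `[0, T], continuous (path_of B w)} ;
  fbm_gaussian : gaussian_process T B ;
  fbm_centered : forall t : R, t \in `[0, T] -> ('E_P[B t] = 0)%E ;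
  fbm_start : forall w, B 0 w = 0 ;
  fbm_covariance : forall s t : R, s \in `[0, T] -> t \in `[0, T] ->
    ('E_P[(fun w => B s w * B t w)%R] =
      (2^-1 * (t `^ (2 * H) + s `^ (2 * H) - `|t - s| `^ (2 * H)))%:E)%E }.

(* For a continuous path the supremum is attained, so this is the maximum. *)
Definition running_max (R : realType) (b : R -> R) (t : R) : R :=
  sup [set b s | s in `[0, t]].

Section generalized_Lebesgue_Stieltjes.
Variables (R : realType) (T : R).
Implicit Types (f g : R -> R) (beta : R).

Local Notation leb := (@lebesgue_measure R).

Definition norm1 beta f : \bar R :=
  ereal_sup [set y | exists s t : R, [/\ 0 <= s, s < t, t <= T &
    y = ((`|f t - f s| / (t - s) `^ beta)%:E +
         \int[leb]_(u in `[s, t])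
           (`|f u - f s| / (u - s) `^ (1 + beta))%:E)%E]].

Definition W1 beta f : Prop :=
  measurable_fun `[0, T] f /\ (norm1 beta f < +oo)%E.

Definition norm2 beta f : \bar R :=
  (\int[leb]_(s in `[0%R, T]) (`|f s| / s `^ beta)%:E +
   \int[leb]_(s in `[0%R, T]) \int[leb]_(u in `[0%R, s])
     (`|f u - f s| / (s - u) `^ (1 + beta))%:E)%E.

Definition W2 beta f : Prop :=
  measurable_fun `[0, T] f /\ (norm2 beta f < +oo)%E.

Definition Gamma (a : R) : R :=
  \int[leb]_(x in `]0, +oo[) (x `^ (a - 1) * expR (- x)).

(* D^beta_{0+} *)
Definition weyl_left beta f (x : R) : R :=
  (Gamma (1 - beta))^-1 *
  (f x / x `^ beta +
   beta * \int[leb]_(y in `[0, x]) ((f x - f y) / (x - y) `^ (beta + 1))) *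
  \1_(`]0, T[%classic) x.

(* D^beta_{T-} *)
Definition weyl_right beta f (x : R) : R :=
  (Gamma (1 - beta))^-1 *
  (f x / (T - x) `^ beta +
   beta * \int[leb]_(y in `[x, T]) ((f x - f y) / (y - x) `^ (beta + 1))) *
  \1_(`]0, T[%classic) x.

(* g_{T-} *)
Definition left_shift g (x : R) : R :=
  (lim (g y @[y --> T^'-]) - g x) * \1_(`]0, T[%classic) x.

(* The generalized Lebesgue-Stieltjes integral of f with respect to g over
   [0, T] exists and equals I. *)
Definition is_gLS_integral f g (I : R) : Prop :=
  exists beta : R, [/\ 0 < beta < 1, W2 beta f, W1 (1 - beta) g &
    I = \int[leb]_(x in `[0, T])
          (weyl_left beta f x * weyl_right (1 - beta) (left_shift g) x)].

End generalized_Lebesgue_Stieltjes.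

(* Main.v *)
Require Import Defs.
From HB Require Import structures.
From mathcomp Require Import all_boot all_order all_algebra.
From mathcomp Require Import all_classical all_reals all_analysis.
From mathcomp Require Import measurable_realfun ring lra.
Import Order.TTheory GRing.Theory Num.Theory.
Import numFieldNormedType.Exports.
Local Open Scope classical_set_scope.
Local Open Scope ring_scope.
Set Implicit Arguments.
Unset Strict Implicit.
Unset Printing Implicit Defensive.

(** Almost surely the set of record times {t | B_t = M_t} is Lebesgue null, so
    its indicator and the left Weyl derivative of that indicator vanish almost
    everywhere, and the integral is 0. The representation would then give
    B_T <= M_T = 0 almost surely, which is absurd for a centered B_T of
    positive variance.

    By Tonelli it suffices that P(B_s <= B_t for all s <= t) = 0 for t > 0.
    Along s = t - t q^k with q small, the normalized increments X_1, ..., X_n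
    have correlations of order 1/n because H < 1. On the event E that they are
    all nonnegative, their sum S equals the sum of the |X_k| and is typically
    of order n, whereas E S^2 is only of order n, not n^2; hence n P(E)^4 stays bounded. *)

(** * Integrals of functions vanishing off a null set *)

Import HBNNSimple.

(** Stated for arbitrary [f], so that it applies directly to products of Weyl derivatives: the
    integral of a nonnegative function is a supremum over simple functions below it, and each of
    these vanishes off [N]. *)
Lemma Rintegral_null (d : measure_display) (X : measurableType d) (R : realType)
    (mu : {measure set X -> \bar R}) (D N : set X) (f : X -> R) :
  measurable D -> measurable N -> mu N = 0%E ->
  (forall x, D x -> ~ N x -> f x = 0) -> \int[mu]_(x in D) f x = 0.
Proof.
move=> mD mN N0 f0.
have key (g : X -> \bar R) : (forall x, D x -> (0 <= g x)%E) ->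
    (forall x, D x -> ~ N x -> g x = 0%E) -> (\int[mu]_(x in D) g x = 0)%E.
  move=> g0 gN.
  apply/eqP; rewrite eq_le integral_ge0// andbT ge0_integralE//.
  apply: ge_ereal_sup => _ [h /= hg <-].
  have h0 x : ~ N x -> h x = 0.
    move=> Nx; apply/eqP; rewrite eq_le fun_ge0 andbT -lee_fin.
    apply: le_trans (hg x) _; rewrite patchE; case: ifPn => // /set_mem Dx.
    by rewrite gN.
  have <- := integralT_nnsfun mu h.
  rewrite (ge0_negligible_integral mN)//.
  - rewrite integral0_eq// => x [_ Nx]; by rewrite /= h0.
  - exact/measurable_EFinP.
  - by move=> x _; rewrite lee_fin.
rewrite /Rintegral integralE key ?key ?sube0//.
- by move=> x Dx Nx; rewrite funeneg.unlock /= f0// oppr0 maxxx.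
- by move=> x Dx Nx; rewrite funepos.unlock /= f0// maxxx.
Qed.

(** * Calculus of finite expectations *)

(** Integrability is bundled with the value, so that real-valued expectations add, scale and compare
    without side conditions. *)
Definition has_mean (d : measure_display) (Omega : measurableType d)
    (R : realType) (P : probability Omega R) (f : Omega -> R) (v : R) : Prop :=
  P.-integrable setT (EFin \o f) /\ (\int[P]_w (f w)%:E)%E = v%:E.

Section has_mean_theory.
Context (d : measure_display) (Omega : measurableType d) (R : realType)
  (P : probability Omega R).
Implicit Types (f g : Omega -> R) (a b : R).

Lemma has_meanD f g a b : has_mean P f a -> has_mean P g b ->
  has_mean P (fun w => f w + g w) (a + b).
Proof.
move=> [If Ef] [Ig Eg]; split; first exact: (integrableD measurableT If Ig).
under eq_integral do rewrite EFinD.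
by rewrite integralD// Ef Eg.
Qed.

Lemma has_meanZ f a k : has_mean P f a -> has_mean P (fun w => k * f w) (k * a).
Proof.
move=> [If Ef]; split; first exact: (integrableZl measurableT k If).
under eq_integral do rewrite EFinM.
by rewrite integralZl// Ef.
Qed.

Lemma has_mean_cst k : has_mean P (fun=> k) k.
Proof.
split; first exact: finite_measure_integrable_cst.
rewrite (integral_cst _ measurableT k%:E).
rewrite -[RHS]mule1; congr (_ * _)%E; exact: probability_setT.
Qed.

Lemma has_mean_sum n (f : 'I_n -> Omega -> R) (a : 'I_n -> R) :
  (forall i, has_mean P (f i) (a i)) ->
  has_mean P (fun w => \sum_(i < n) f i w) (\sum_(i < n) a i).
Proof.
elim: n f a => [|n IH] f a fa.
  rewrite big_ord0; under eq_fun do rewrite big_ord0.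
  exact: has_mean_cst.
rewrite big_ord_recl; under eq_fun do rewrite big_ord_recl.
by apply: has_meanD => //; exact: IH.
Qed.

Lemma has_mean_indic (A : set Omega) : measurable A ->
  has_mean P \1_A (fine (P A)).
Proof.
move=> mA; split.
  exact: integrable_indic.
by rewrite integral_indic// setIT fineK// fin_num_measure.
Qed.

Lemma has_mean_le f g a b : has_mean P f a -> has_mean P g b ->
  (forall w, f w <= g w) -> a <= b.
Proof.
move=> [If Ef] [Ig Eg] fg; rewrite -lee_fin -Ef -Eg.
by apply: le_integral => // w _; rewrite lee_fin.
Qed.

Lemma has_mean_uniq f a b : has_mean P f a -> has_mean P f b -> a = b.
Proof. by move=> [_ fa] [_ fb]; apply: EFin_inj; rewrite -fa -fb. Qed.

End has_mean_theory.

(** * Second moments and small balls of normal laws *)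

(** The Radon-Nikodym derivative and [normal_pdf] have the same integral over every measurable set,
    hence agree almost everywhere. *)
Lemma ge0_integral_normal_prob (R : realType) (m s : R) (f : R -> \bar R) :
  measurable_fun setT f -> (forall x, (0 <= f x)%E) ->
  (\int[normal_prob m s]_x f x =
   \int[lebesgue_measure]_x (f x * (normal_pdf m s x)%:E))%E.
Proof.
move=> mf f0.
have dom := normal_prob_dominates m s.
rewrite -(Radon_Nikodym_SigmaFinite.change_of_variables dom)//.
have mpdf : measurable_fun setT (EFin \o normal_pdf m s).
  by apply: measurableT_comp => //; exact: measurable_normal_pdf.
have Iff := Radon_Nikodym_SigmaFinite.f_integrable dom.
apply: ae_eq_integral => //.
- by apply: emeasurable_funM => //; exact: measurable_int Iff.
- exact: emeasurable_funM.
- apply: ae_eqe_mul2l => /=.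
  apply: integral_ae_eq => //= E _ mE.
  by rewrite -Radon_Nikodym_SigmaFinite.f_integral.
Qed.

(* With y = ((x - m) / s) ^ 2 the ratio of the two sides is y exp (- 3 y / 8) / 3,
   so that second moments of the normal law need not be computed. *)
Lemma normal_pdf_sqr_le (R : realType) (m s x : R) : s != 0 ->
  (x - m) ^+ 2 * normal_pdf m s x <= 6 * s ^+ 2 * normal_pdf m (2 * s) x.
Proof.
move=> s0; rewrite !normal_pdfE ?mulf_neq0//.
have -> : normal_peak (2 * s) = normal_peak s / 2.
  rewrite /normal_peak -invfM; congr (_^-1).
  rewrite (_ : (2 * s) ^+ 2 * pi *+ 2 = (s ^+ 2 * pi *+ 2) * 2 ^+ 2).
    by rewrite sqrtrM ?sqrtr_sqr ?ger0_norm// mulrn_wge0// mulr_ge0 ?sqr_ge0// pi_ge0.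
  by rewrite exprMn; ring.
pose y := (x - m) ^+ 2 / s ^+ 2.
have s2_neq0 : s ^+ 2 != 0 by rewrite sqrf_eq0.
have y_ge0 : 0 <= y by rewrite divr_ge0 ?sqr_ge0.
have -> : (x - m) ^+ 2 = s ^+ 2 * y by rewrite /y mulrC divfK.
have -> : normal_fun m s x = expR (- (3 / 8 * y)) * normal_fun m (2 * s) x.
  rewrite /normal_fun -expRD; congr expR; rewrite /y.
  by rewrite exprMn; field.
set e := expR _; set F := normal_fun _ _ _.
have ey : y * e <= 3.
  rewrite /e expRN ler_pdivrMr ?expR_gt0//.
  by have := expR_ge1Dx (3 / 8 * y); lra.
have ey3 : 0 <= 3 - y * e by lra.
have : 0 <= s ^+ 2 * normal_peak s * F * (3 - y * e).
  apply: mulr_ge0 => //; apply: mulr_ge0; last exact: normal_fun_ge0.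
  by apply: mulr_ge0; [exact: sqr_ge0|exact: normal_peak_ge0].
lra.
Qed.

(** Serves to bound [s] from below when the second moment about [m] is known to be at least 1. *)
Lemma normal_prob_sqr_le (R : realType) (m s : R) : s != 0 ->
  (\int[normal_prob m s]_x ((x - m) ^+ 2)%:E <= (6 * s ^+ 2)%:E)%E.
Proof.
move=> s0.
rewrite ge0_integral_normal_prob; last 2 first.
- apply/measurable_EFinP; apply: measurable_funX => //; exact: measurable_funB.
- by move=> x; rewrite lee_fin sqr_ge0.
apply: (@le_trans _ _ (\int[lebesgue_measure]_x
    ((6 * s ^+ 2)%:E * (normal_pdf m (2 * s) x)%:E))%E).
  apply: ge0_le_integral => //=.
  - by move=> x _; rewrite -EFinM lee_fin mulr_ge0 ?sqr_ge0 ?normal_pdf_ge0.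
  - apply/measurable_EFinP; apply: measurable_funM; last exact: measurable_normal_pdf.
    apply: measurable_funX => //; exact: measurable_funB.
  - by apply/measurable_EFinP; apply: measurable_funM => //; exact: measurable_normal_pdf.
  - by move=> x _; rewrite -!EFinM lee_fin normal_pdf_sqr_le.
rewrite integralZl//; last exact: integrable_normal_pdf.
by rewrite integral_normal_pdf mule1.
Qed.


Lemma normal_peak_le2 (R : realType) (s : R) : 1 <= 6 * s ^+ 2 ->
  normal_peak s <= 2.
Proof.
move=> s1.
(* Since [pi >= 2], the right side is at least [4 s^2 >= 2/3]. *)
have A_ge : (2^-1) ^+ 2 <= s ^+ 2 * pi *+ 2.
  have := ler_wpM2l (sqr_ge0 s) (@pi_ge2 R); rewrite exprVn mulr2n.
  have -> : (2 ^+ 2)^-1 = 4^-1 :> R by congr (_^-1); ring.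
  lra.
have half_le : 2^-1 <= Num.sqrt (s ^+ 2 * pi *+ 2).
  rewrite -[leLHS]ger0_norm ?invr_ge0// -sqrtr_sqr ler_sqrt//.
  exact: le_trans (sqr_ge0 _) A_ge.
rewrite /normal_peak -[leRHS]invrK lef_pV2 ?posrE ?invr_gt0//.
by apply: lt_le_trans half_le; rewrite invr_gt0.
Qed.

Lemma normal_prob_itv_le (R : realType) (m s e : R) : s != 0 -> 0 <= e ->
  (normal_prob m s `[0%R, e[ <= (normal_peak s * e)%:E)%E.
Proof.
move=> s0 e0; rewrite /normal_prob.
set D : set R := [set` `[0, e[].
have mD : measurable D by exact: measurable_itv.
apply: (@le_trans _ _ (\int[lebesgue_measure]_(x in D) (normal_peak s)%:E)%E).
  apply: ge0_le_integral => //=.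
  - by move=> x _; rewrite lee_fin normal_pdf_ge0.
  - by apply/measurable_EFinP/measurable_funTS; exact: measurable_normal_pdf.
  - by move=> x _; rewrite lee_fin normal_pdf_ub.
rewrite integral_cst//= lebesgue_measure_itv/= lte_fin.
case: ifPn => [_|]; first by rewrite oppr0 adde0.
by rewrite mule0 lee_fin mulr_ge0 ?normal_peak_ge0.
Qed.


(** The parameters of the law are only estimated: [E (X - m)^2 = 1 + m^2 >= 1] excludes a point mass
    at [m] and forces [6 s^2 >= 1], so the density is at most 2. *)
Lemma standardized_small_ball (d : measure_display) (Omega : measurableType d)
    (R : realType) (P : probability Omega R) (X : Omega -> R) (e : R) :
  gaussian_rv P X -> has_mean P X 0 -> has_mean P (fun w => X w ^+ 2) 1 ->
  0 <= e -> (P (X @^-1` `[0%R, e[) <= (2 * e)%:E)%E.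
Proof.
move=> [m [s [s_ge0 lawX]]] EX EX2 e0.
have EXm : has_mean P (fun w => (X w - m) ^+ 2) (1 + m ^+ 2).
  have := has_meanD (has_meanD EX2 (has_meanZ (- (2 * m)) EX)) (has_mean_cst P (m ^+ 2)).
  rewrite mulr0 addr0; congr has_mean; apply/funext => w; ring.
have mXm : measurable_fun setT (fun x : R => ((x - m) ^+ 2)%:E).
  by apply/measurable_EFinP; apply: measurable_funX => //; exact: measurable_funB.
have Xm_ge0 (x : R) : (0 <= ((x - m) ^+ 2)%:E)%E by rewrite lee_fin sqr_ge0.
(* [normal_prob] is a measure on [measurableTypeR R], whose display differs from
   that of the canonical measurable structure of [R]. *)
have mX : measurable_fun setT (X : Omega -> measurableTypeR R).
  by apply/measurable_EFinP; case: EX => /(measurable_int P).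
pose Y : {mfun Omega >-> measurableTypeR R} :=
  @mfun_Sub _ _ Omega (measurableTypeR R) X (mem_set mX).
have := @ge0_integral_distribution _ _ _ _ _ P Y _ mXm Xm_ge0.
rewrite [RHS]EXm.2.
case: (eqVneq s 0) lawX => [s0|s0] lawX.
  rewrite (eq_measure_integral (\d_(m : measurableTypeR R))) => [|A mA _]; last exact: lawX.
  rewrite integral_dirac// diracT mul1e subrr expr0n/= => h.
  have {}h : 0 = 1 + m ^+ 2 :> R by exact: EFin_inj h.
  by exfalso; have := sqr_ge0 m; lra.
rewrite (eq_measure_integral (normal_prob m s)) => [Esq|A mA _]; last exact: lawX.
have := normal_prob_sqr_le m s0; rewrite Esq lee_fin => sqr_le.
rewrite lawX//; apply: le_trans (normal_prob_itv_le m s0 e0) _.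
rewrite lee_fin ler_wpM2r// normal_peak_le2//.
by have := sqr_ge0 m; lra.
Qed.

(** * Nearly uncorrelated Gaussians are rarely all nonnegative *)

Lemma gaussian_orthant_bound (d : measure_display) (Omega : measurableType d)
    (R : realType) (P : probability Omega R) (n : nat)
    (X : 'I_n -> Omega -> R) (r : 'I_n -> 'I_n -> R) (E : set Omega) :
  (forall i, gaussian_rv P (X i)) -> (forall i, has_mean P (X i) 0) ->
  (forall i j, has_mean P (fun w => X i w * X j w) (r i j)) ->
  (forall i, r i i = 1) -> (forall i j, i != j -> r i j <= 2 / n%:R) ->
  measurable E -> (forall w i, E w -> 0 <= X i w) ->
  n%:R * fine (P E) ^+ 4 <= 256.
Proof.
move=> gX mX0 mXX r1 rn mE E_ge0.
set p := fine (P E).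
have p_ge0 : 0 <= p by rewrite fine_ge0.
have pE : P E = p%:E by rewrite fineK// fin_num_measure.
have mX i : measurable_fun setT (X i).
  by apply/measurable_EFinP; case: (mX0 i) => /(measurable_int P).
(* The radius [p / 4] makes the small ball bound [2 * (p / 4)] exactly half of [P E], so that [F i]
   keeps the other half. *)
pose G i := X i @^-1` `[0, (p / 4)[.
pose F i := E `\` G i.
have mG i : measurable (G i).
  by rewrite /G -[X in measurable X]setTI; exact: mX.
have mF i : measurable (F i) by exact: measurableD.
have F_ge i : p / 2 <= fine (P (F i)).
  have small : (P (G i) <= (2 * (p / 4))%:E)%E.
    apply: standardized_small_ball => //; last by rewrite divr_ge0.
    by rewrite -(r1 i); exact: mXX.
  have : (P E <= P (F i) + P (G i))%E.
    apply: le_trans (measureU2 P _ _) => //.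
    apply: le_measure; rewrite ?inE//; first exact: measurableU.
    by move=> w Ew; have [|] := pselect (G i w); [right|left].
  rewrite pE -[P (F i)]fineK ?fin_num_measure// => /le_trans.
  move=> /(_ _ (leeD2l _ small)); rewrite -EFinD lee_fin; lra.
pose S w := \sum_(i < n) X i w.
have ES : has_mean P (fun w => S w ^+ 2) (\sum_(i < n) \sum_(j < n) r i j).
  have := has_mean_sum (fun i => has_mean_sum (mXX i)).
  congr has_mean; apply/funext => w; rewrite /S expr2 big_distrl/=.
  by apply: eq_bigr => i _; rewrite big_distrr.
(* Each row sums to at most [1 + n * (2 / n) = 3]. *)
have ES_le : \sum_(i < n) \sum_(j < n) r i j <= 3 * n%:R.
  apply: (@le_trans _ _ (\sum_(i < n) 3)); last first.
    by rewrite sumr_const card_ord mulr_natr.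
  apply: ler_sum => i _; rewrite (bigD1 i)//= r1.
  have n_gt0 : 0 < n%:R :> R by rewrite ltr0n; case: (n) i => [[]|].
  apply: (@le_trans _ _ (1 + \sum_(j < n | j != i) 2 / n%:R)).
    by rewrite lerD2l; apply: ler_sum => j ji; apply: rn; rewrite eq_sym.
  apply: (@le_trans _ _ (1 + \sum_(j < n) 2 / n%:R)).
    rewrite lerD2l big_mkcond/=; apply: ler_sum => j _.
    by case: ifP => // _; rewrite divr_ge0.
  by rewrite sumr_const card_ord -[X in _ + X]mulr_natr divfK ?gt_eqF//; lra.
pose c := n%:R * p ^+ 2 / 8.
have c_ge0 : 0 <= c by rewrite divr_ge0// mulr_ge0// sqr_ge0.
(* On E, (p / 4) #{i | p / 4 <= X i} <= S = |S|; then 2 c |S| <= S ^ 2 + c ^ 2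
   lets the second moment of S control the expectation, and the value of c
   optimizes the resulting bound up to a constant. *)
have mL := has_mean_sum
  (fun i => has_meanZ (2 * c * (p / 4)) (has_mean_indic P (mF i))).
have mU := has_meanD ES (has_mean_cst P (c ^+ 2)).
have : \sum_(i < n) 2 * c * (p / 4) * fine (P (F i)) <=
    \sum_(i < n) \sum_(j < n) r i j + c ^+ 2.
  apply: has_mean_le mL mU _ => w /=.
  rewrite -mulr_sumr.
  have SF : (p / 4) * (\sum_(i < n) \1_(F i) w) <= `|S w|.
    have [Ew|nEw] := pselect (E w); last first.
      rewrite big1 ?mulr0// => i _; rewrite indicE memNset// => -[].
      by [].
    apply: le_trans (ler_norm _); rewrite mulr_sumr; apply: ler_sum => i _.
    rewrite indicE; have [/set_mem[_ nG]|_] := boolP (w \in F i); last first.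
      by rewrite mulr0 E_ge0.
    rewrite mulr1 leNgt; apply/negP => lt_p4; apply: nG.
    by rewrite /G/= in_itv/= E_ge0.
  have : 0 <= (`|S w| - c) ^+ 2 by exact: sqr_ge0.
  rewrite sqrrB real_normK ?num_real// => hc.
  have := ler_wpM2l (mulr_ge0 (ler0n R 2) c_ge0) SF.
  by lra.
have : n%:R * (2 * c * (p / 4) * (p / 2)) <=
    \sum_(i < n) 2 * c * (p / 4) * fine (P (F i)).
  rewrite mulr_natl -[in X in X <= _](card_ord n) -sumr_const.
  apply: ler_sum => i _.
  by rewrite ler_wpM2l// !mulr_ge0.
move=> h1 h2.
have {h1 h2} h : n%:R * (2 * c * (p / 4) * (p / 2)) <= 3 * n%:R + c ^+ 2 by lra.
have [->|n_neq0] := eqVneq n 0%N; first by rewrite mul0r.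
have n_gt0 : 0 < n%:R :> R by rewrite ltr0n lt0n.
rewrite -(ler_pM2l n_gt0).
(* For this [c] the left side of [h] is [2 c^2], so [c^2 <= 3 n], that is [n p^4 <= 192]. *)
move: h; rewrite /c; move: (n%:R) n_gt0 => k k0; nra.
Qed.

(** * Covariances of fractional Brownian motion and its increments *)

Definition fbm_cov (R : realType) (H s t : R) : R :=
  2^-1 * (t `^ (2 * H) + s `^ (2 * H) - `|t - s| `^ (2 * H)).

Lemma fbm_covC (R : realType) (H s t : R) : fbm_cov H s t = fbm_cov H t s.
Proof. by rewrite /fbm_cov distrC (addrC (t `^ _)). Qed.

Lemma fbm_cov_diag (R : realType) (H s : R) :
  H != 0 -> fbm_cov H s s = s `^ (2 * H).
Proof.
move=> H0; rewrite /fbm_cov subrr normr0 powR0 ?mulf_neq0//; lra.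
Qed.

(** By scaling, the left side is [(x^(2H) + 1 - (1 - x)^(2H)) / (2 x^H)]. As [1 < 2H < 2], one has
    [x^(2H) <= x] and [(1 - x)^(2H) >= (1 - x)^2 >= 1 - 2x], so the numerator is at most
    [3 x = 3 x^(1-H) x^H]. *)
Lemma fbm_cov_normalized_le (R : realType) (H r x : R) :
  2^-1 < H < 1 -> 0 < r -> 0 < x < 1 ->
  (r `^ H)^-1 * ((r * x) `^ H)^-1 * fbm_cov H r (r * x) <= 3 / 2 * x `^ (1 - H).
Proof.
move=> /andP[H_gt H_lt] r0 /andP[x0 x1].
have x1_ge0 : 0 <= 1 - x by lra.
have pow2 a : 0 < a -> a `^ (2 * H) = (a `^ H) ^+ 2 :> R.
  move=> a0; rewrite -powR_mulrn ?powR_ge0// -powRrM mulrC//.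
rewrite /fbm_cov distrC (_ : r - r * x = r * (1 - x)); last by ring.
rewrite ger0_norm ?mulr_ge0 ?(ltW r0)// !powRM ?(ltW r0) ?(ltW x0)//.
rewrite (pow2 r)// (pow2 x)//.
have x_le : (x `^ H) ^+ 2 <= x.
  rewrite -pow2// -[leRHS]powRr1 ?(ltW x0)//.
  apply: ger_powR; last lra.
  by rewrite x0 ltW.
have x1_le : 1 - 2 * x <= (1 - x) `^ (2 * H).
  apply: (@le_trans _ _ ((1 - x) `^ 2)).
    by rewrite powR_mulrn//; have := sqr_ge0 x; lra.
  apply: ger_powR; last lra.
  apply/andP; split; lra.
have xH : x = x `^ (1 - H) * x `^ H.
  by rewrite -powRD ?(gt_eqF x0) ?implybT// subrK powRr1// ltW.
have rho0 : 0 < r `^ H by rewrite powR_gt0.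
have xi0 : 0 < x `^ H by rewrite powR_gt0.
move: xH x_le x1_le.
move: (x `^ (1 - H)) (x `^ H) xi0 (r `^ H) rho0 ((1 - x) `^ (2 * H)).
move=> z xi xi0 rho rho0 y xH x_le x1_le.
rewrite (_ : _ * _ = (2^-1 * (xi ^+ 2 + 1 - y)) / xi); last first.
  by field; rewrite !gt_eqF.
by rewrite ler_pdivrMr// -(mulrA (3 / 2)) -xH; lra.
Qed.

Section fbm.
Context (d : measure_display) (Omega : measurableType d) (R : realType)
  (P : probability Omega R) (T H : R) (B : R -> {RV P >-> R})
  (H_range : 2^-1 < H < 1) (fbmB : fractional_brownian_motion T H B).

(** Integrability comes from [|B_s B_t| <= B_s^2 + B_t^2], the squares being integrable by the
    covariance formula on the diagonal. *)
Lemma fbm_has_cov s t : s \in `[0, T] -> t \in `[0, T] ->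
  has_mean P (fun w => B s w * B t w) (fbm_cov H s t).
Proof.
move=> sT tT; have := fbm_covariance fbmB sT tT.
rewrite unlock => EBB; split => //.
have sq u : u \in `[0, T] -> P.-integrable setT (EFin \o (fun w => B u w ^+ 2)).
  move=> uT; apply/integrableP; split.
    by apply/measurable_EFinP; exact: measurable_funX.
  have := fbm_covariance fbmB uT uT; rewrite unlock.
  under eq_integral do rewrite -expr2.
  under [X in _ -> (X < _)%E]eq_integral do rewrite /= ger0_norm ?sqr_ge0//.
  by move=> ->; rewrite ltry.
apply: (le_integrable measurableT _ _ (integrableD measurableT (sq s sT) (sq t tT))).
  by apply/measurable_EFinP; exact: measurable_funM.
move=> w _ /=; rewrite lee_fin [leRHS]ger0_norm ?addr_ge0 ?sqr_ge0//.
rewrite normrM -(real_normK (num_real (B s w))) -(real_normK (num_real (B t w))).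
have := sqr_ge0 (`|B s w| - `|B t w|).
have := mulr_ge0 (normr_ge0 (B s w)) (normr_ge0 (B t w)).
by rewrite sqrrB mulr2n; lra.
Qed.

Lemma fbm_has_mean0 t : t \in `[0, T] -> has_mean P (B t) 0.
Proof.
move=> tT; have := fbm_centered fbmB tT; rewrite unlock => EB; split => //.
have [Isq _] := has_meanD (fbm_has_cov tT tT) (has_mean_cst P 1).
apply: (le_integrable measurableT _ _ Isq); first exact/measurable_EFinP.
move=> w _ /=; rewrite lee_fin [leRHS]ger0_norm ?addr_ge0 -?expr2 ?sqr_ge0//.
have := sqr_ge0 (`|B t w| - 1); rewrite -(real_normK (num_real (B t w))).
have := normr_ge0 (B t w); lra.
Qed.

(** Looking back from [t], the increments have the covariance of the process itself; this follows by
    bilinear expansion. *)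
Lemma fbm_increment_cov (t r u : R) :
  t \in `[0, T] -> r \in `[0, t] -> u \in `[0, t] ->
  has_mean P (fun w => (B t w - B (t - r) w) * (B t w - B (t - u) w))
    (fbm_cov H r u).
Proof.
move=> tT rt ut.
have sub_mem s : s \in `[0, t] -> t - s \in `[0, T].
  by move: tT; rewrite !in_itv/= => /andP[? ?] /andP[? ?]; apply/andP; split; lra.
have := has_meanD
  (has_meanD (fbm_has_cov tT tT) (has_meanZ (-1) (fbm_has_cov tT (sub_mem u ut))))
  (has_meanD (has_meanZ (-1) (fbm_has_cov (sub_mem r rt) tT))
             (fbm_has_cov (sub_mem r rt) (sub_mem u ut))).
congr has_mean; first by apply/funext => w; ring.
have ger u' : u' \in `[0, t] -> `|u'| = u'.
  by rewrite in_itv/= => /andP[? _]; rewrite ger0_norm.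
have -> : fbm_cov H t t = t `^ (2 * H).
  by rewrite fbm_cov_diag// gt_eqF//; case/andP: H_range; lra.
rewrite /fbm_cov.
rewrite (_ : t - u - t = - u) ?normrN ?(ger u ut); last by ring.
rewrite (_ : t - (t - r) = r) ?(ger r rt); last by ring.
rewrite (_ : t - u - (t - r) = - (u - r)) ?normrN; last by ring.
lra.
Qed.

(** * Records at a fixed time have probability zero *)

(** Countably many comparison times keep the event measurable. They include every [t - t q^k] with
    [1 / q] a positive integer. *)
Definition fbm_past_record (t : R) : set Omega :=
  [set w | forall j : nat, B (t - t / j.+1%:R) w <= B t w].

Lemma measurable_fbm_past_record t : measurable (fbm_past_record t).
Proof.
rewrite (_ : fbm_past_record t =
    \bigcap_j [set w | B (t - t / j.+1%:R) w <= B t w]); last first.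
  by apply/seteqP; split => [w h j _|w h j]; exact: h.
apply: bigcapT_measurable => j.
rewrite -[X in measurable X]setTI.
exact: measurable_fun_le.
Qed.

Lemma fbm_past_record_null t : 0 < t <= T -> P (fbm_past_record t) = 0%E.
Proof.
move=> /andP[t0 tT]; case/andP: (H_range) => H_gt H_lt.
have tT' : t \in `[0, T] by rewrite in_itv/= tT ltW.
have mE := measurable_fbm_past_record t.
(* A fixed number whose fourth power is at most [256 / n] for all [n > 0] is zero. *)
suff bound n : n%:R * fine (P (fbm_past_record t)) ^+ 4 <= 256.
  rewrite -[P _]fineK ?fin_num_measure//; congr EFin; apply/eqP.
  move: bound; set p := fine _ => bound.
  apply/negPn/negP => p0.
  have p4 : 0 < p ^+ 4 by rewrite lt_def expf_neq0// exprn_ge0// fine_ge0.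
  have := bound (Num.bound (256 / p ^+ 4)).
  rewrite -ler_pdivlMr// leNgt => /negP; apply.
  by apply: le_lt_trans (archi_boundP _); rewrite ?divr_ge0 ?(ltW p4).
case: n => [|n]; first by rewrite mul0r.
pose a := 1 - H; have a0 : 0 < a by rewrite subr_gt0.
(* Chosen so that [delta^(1-H) = 1 / n.+1], the required order of the correlations. *)
pose delta := (n.+1%:R^-1) `^ a^-1 : R.
have delta0 : 0 < delta by rewrite powR_gt0// invr_gt0.
have [N N_delta] : exists N : nat, N.+2%:R^-1 <= delta.
  exists (Num.bound delta^-1).
  rewrite invf_ple ?posrE// ltW//; apply: lt_le_trans (archi_boundP _) _.
    by rewrite invr_ge0 ltW.
  by rewrite ler_nat -addn2 leq_addr.
(* A reciprocal integer puts the times [t - t q^k] among those of [fbm_past_record]; the integer is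
   at least 2 so that [q < 1]. *)
pose q : R := N.+2%:R^-1.
have q0 : 0 < q by rewrite invr_gt0.
have q1 : q < 1 by rewrite invf_lt1// ltr1n.
have q_pow : q `^ a <= n.+1%:R^-1.
  apply: (@le_trans _ _ (delta `^ a)).
    by apply: ge0_ler_powR; rewrite ?nnegrE// ltW.
  by rewrite /delta -powRrM mulVf ?gt_eqF// powRr1.
pose r (k : nat) := t * q ^+ k.
have r_gt0 k : 0 < r k by rewrite mulr_gt0// exprn_gt0.
have r_mem k : r k \in `[0, t].
  rewrite in_itv/= ltW//= -[leRHS]mulr1 ler_pM2l//.
  by rewrite exprn_ile1 ?ltW.
(* The standard deviation of the increment over length [r i] is [r i ^ H]. *)
pose X (i : 'I_n.+1) w := (r i `^ H)^-1 * (B t w - B (t - r i) w).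
pose rho (i j : 'I_n.+1) := (r i `^ H)^-1 * (r j `^ H)^-1 * fbm_cov H (r i) (r j).
have tr_mem i : t - r i \in `[0, T].
  move: (r_mem i); rewrite !in_itv/= => /andP[? ?].
  by have ? := r_gt0 i; apply/andP; split; lra.
have rho_sym i j : rho i j = rho j i by rewrite /rho fbm_covC (mulrC (_^-1)).
(* The ratio of scales is [q^(j-i) <= q], so the correlation is at most [(3/2) q^(1-H)], hence below
   [2 / n.+1]. *)
have rho_lt (i j : 'I_n.+1) : (i < j)%N -> rho i j <= 2 / n.+1%:R.
  move=> ij.
  have rq : r j = r i * q ^+ (j - i).
    by rewrite /r -mulrA -exprD subnKC// ltnW.
  rewrite /rho rq.
  have qji : q ^+ (j - i) <= q.
    by rewrite -[leRHS]expr1 ler_wiXn2l ?ltW// subn_gt0.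
  apply: le_trans (fbm_cov_normalized_le H_range (r_gt0 i) _) _.
    by rewrite exprn_gt0//= (le_lt_trans qji).
  have : (q ^+ (j - i)) `^ a <= q `^ a.
    by apply: ge0_ler_powR; rewrite ?nnegrE// ltW// exprn_gt0.
  rewrite -/a => h; have := le_trans h q_pow.
  have : 0 < n.+1%:R^-1 :> R by rewrite invr_gt0.
  move: (n.+1%:R^-1 : R) ((q ^+ (j - i)) `^ a) => z y z0 yz.
  lra.
apply: (@gaussian_orthant_bound _ _ _ P _ X rho) => //.
- move=> i; have := fbm_gaussian fbmB (n := 2) 
    (t := fun k => if k == ord0 then t else t - r i)
    (fun k => if k == ord0 then (r i `^ H)^-1 else - (r i `^ H)^-1).
  have -> : (fun w => \sum_(k < 2)
      (if k == ord0 then (r i `^ H)^-1 else - (r i `^ H)^-1) *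
      B (if k == ord0 then t else t - r i) w) = X i.
    by apply/funext => w; rewrite !big_ord_recl big_ord0 /= /X; ring.
  by apply => k; case: ifP.
- move=> i; have := has_meanZ (r i `^ H)^-1 
    (has_meanD (fbm_has_mean0 tT') (has_meanZ (-1) (fbm_has_mean0 (tr_mem i)))).
  rewrite !mulr0 addr0 mulr0; congr has_mean; apply/funext => w.
  rewrite /X; ring.
- move=> i j.
  have := has_meanZ ((r i `^ H)^-1 * (r j `^ H)^-1)
    (fbm_increment_cov tT' (r_mem i) (r_mem j)).
  congr has_mean; apply/funext => w; rewrite /X; ring.
- move=> i; rewrite /rho fbm_cov_diag ?gt_eqF//; last lra.
  have -> : 2 * H = H + H by lra.
  have rH : r i `^ H != 0 by rewrite gt_eqF// powR_gt0.
  by rewrite powRD ?(gt_eqF (r_gt0 i)) ?implybT// mulrACA mulVf// mulr1.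
- move=> i j ij; case: (ltngtP i j) => [||/ord_inj ij']; [exact: rho_lt| |].
    by rewrite rho_sym; exact: rho_lt.
  by rewrite ij' eqxx in ij.
- move=> w i Ew; rewrite /X mulr_ge0 ?invr_ge0 ?powR_ge0// subr_ge0.
  (* The index is shifted by one because the comparison times are [t - t / j.+1]. *)
  have := Ew (N.+2 ^ i).-1.
  rewrite prednK ?expn_gt0// natrX.
  by rewrite /r exprVn.
Qed.

End fbm.

(** * Joint measurability and Tonelli's theorem *)

(** The process is the pointwise limit of its values at times rounded down to the grid of mesh
    [1 / m.+1], which are measurable on countably many rectangles. Rounding down keeps the times in
    [[0, T]], where the path is continuous. *)
Lemma measurable_continuous_process (d : measure_display)
    (Omega : measurableType d) (R : realType) (T : R) (X : R -> Omega -> R) :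
  (forall t, measurable_fun setT (X t)) ->
  (forall w, {within `[0, T], continuous (X ^~ w)}) ->
  measurable_fun (`[0, T]%classic `*` setT : set (measurableTypeR R * Omega))
    (fun p => X p.1 p.2).
Proof.
move=> mX cX.
pose k m (t : R) := Num.trunc (m.+1%:R * t).
pose s m (t : R) : R := (k m t)%:R / m.+1%:R.
have s_itv m t : 0 <= t -> t - m.+1%:R^-1 <= s m t <= t.
  move=> t0; have m0 : 0 < m.+1%:R :> R by [].
  have /andP[ks kS] := trunc_itv (mulr_ge0 (ltW m0) t0).
  apply/andP; split; last by rewrite ler_pdivrMr// mulrC.
  rewrite ler_pdivlMr// mulrBl mulVf ?gt_eqF// lerBlDr natr1 mulrC.
  exact: ltW.
apply: (@measurable_fun_cvg _ _ _ _ (fun m p => X (s m p.1) p.2)).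
  move=> m mD Y mY.
  rewrite (_ : _ `&` _ = \bigcup_i
      ((`[0, T] `&` (`[i%:R / m.+1%:R, i.+1%:R / m.+1%:R[%classic : set R)) `*`
        (X (i%:R / m.+1%:R) @^-1` Y))).
    apply: bigcupT_measurable => i; apply: measurableX.
      by apply: measurableI; exact: measurable_itv.
    by rewrite -[X in measurable X]setTI; exact: mX.
  have m0 : 0 < m.+1%:R :> R by [].
  apply/seteqP; split=> [[t w] /= [[tT _] Yw]|[t w] /= [i _ [[tT ti] Yw]]].
    exists (k m t) => //; split => //; split => //=.
    move: tT; rewrite !in_itv/= => /andP[t0 _].
    have := trunc_itv (mulr_ge0 (ltW m0) t0).
    by rewrite ler_pdivrMr// ltr_pdivlMr// (mulrC t).
  split => //; suff -> : s m t = i%:R / m.+1%:R by [].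
  congr (_%:R / _); apply: trunc_def.
  by move: ti; rewrite /= in_itv/= ler_pdivrMr// ltr_pdivlMr// (mulrC t).
move=> [t w] /= [tT _].
have t0 : 0 <= t by move: tT; rewrite in_itv/= => /andP[].
have s_cvg : s ^~ t @ \oo --> t.
  apply: (@squeeze_cvgr _ _ _ _ (fun m => t - m.+1%:R^-1) (cst t)).
  - by near=> m; exact: s_itv.
  - rewrite -[X in _ --> X]subr0; apply: cvgB; first exact: cvg_cst.
    exact: cvg_harmonic.
  - exact: cvg_cst.
have Xc := (subspace_continuousP _ _).1 (cX w) t tT.
apply: (cvg_comp (s ^~ t) (X ^~ w) _ Xc) => U /= /s_cvg sU.
have {}sU : \forall m \near \oo, `[0, T]%classic (s m t) -> U (s m t) := sU.
suff : \forall m \near \oo, U (s m t) by [].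
apply: filterS sU => m; apply.
move: tT; rewrite /= !in_itv/= => /andP[_ tT].
have /andP[_ st] := s_itv m t t0.
by rewrite (le_trans st)// andbT divr_ge0.
Unshelve. all: by end_near. Qed.

(** Time 0 is left out: every path meets the comparisons there, so its section would have full
    probability. *)
Definition past_records (R : realType) (T : R) (b : R -> R) : set R :=
  [set t | 0 < t <= T /\ forall j : nat, b (t - t / j.+1%:R) <= b t].

Lemma ae_null_past_records (d : measure_display) (Omega : measurableType d)
    (R : realType) (P : probability Omega R) (T H : R) (B : R -> {RV P >-> R}) :
  2^-1 < H < 1 -> fractional_brownian_motion T H B ->
  {ae P, forall w,
    measurable (past_records T (path_of B w) : set (measurableTypeR R)) /\
    lebesgue_measure (past_records T (path_of B w)) = 0%E}.
Proof.
move=> H_range fbmB.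
pose D : set (measurableTypeR R * Omega) := `[0, T]%classic `*` setT.
pose D' : set (measurableTypeR R * Omega) := `]0, T]%classic `*` setT.
have mD : measurable D by apply: measurableX => //; exact: measurable_itv.
have mD' : measurable D' by apply: measurableX => //; exact: measurable_itv.
have mG : measurable_fun D (fun p => B p.1 p.2 : R).
  apply: measurable_continuous_process (fbm_continuous fbmB) => t.
  exact: measurable_funPT.
pose phi (j : nat) (p : measurableTypeR R * Omega) : measurableTypeR R * Omega :=
  (p.1 - p.1 / j.+1%:R, p.2).
have mphi j : measurable_fun D' (phi j).
  apply: measurable_funTS; apply/measurable_fun_pairP; split => /=.
    apply: measurable_funB; first exact: measurable_fst.
    by apply: measurable_funM => //; exact: measurable_fst.
  exact: measurable_snd.
have past_itv (t : R) (j : nat) : 0 < t <= T -> 0 <= t - t / j.+1%:R <= T.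
  move=> /andP[t0 tT].
  have : 0 <= t / j.+1%:R <= t.
    by rewrite divr_ge0 ?(ltW t0)//= ler_pdivrMr// ler_peMr ?(ltW t0)// ler1n.
  by move: (t / _) => y /andP[? ?]; apply/andP; split; lra.
have phiD j : phi j @` D' `<=` D.
  move=> _ [[t w] [/= tT _] <-]; split => //=.
  by move: tT; rewrite !in_itv/=; exact: past_itv.
have sD' : D' `<=` D.
  move=> [t w] [/= tT _]; split => //=.
  by move: tT; rewrite !in_itv/= => /andP[/ltW -> ->].
pose A := \bigcap_j (D' `&` [set p | B (phi j p).1 (phi j p).2 <= B p.1 p.2]).
have mA : measurable A.
  apply: bigcapT_measurable => j; apply: measurable_fun_le => //.
    exact: measurable_comp mD (phiD j) mG (mphi j).
  exact: measurable_funS mG.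
have AE w : ysection A w = past_records T (path_of B w).
  apply/seteqP; split => t.
    rewrite /ysection/= inE => At; split.
      by have [[]] := At 0%N I; rewrite /= in_itv.
    by move=> j; have [] := At j I.
  move=> [tT Bt]; rewrite /ysection/= inE => j _; split => /=.
    by split => //=; rewrite in_itv.
  exact: Bt.
have Ax t : P (xsection A t) = 0%E.
  have [tT|tT] := boolP (0 < t <= T).
    rewrite -(fbm_past_record_null H_range fbmB tT); congr (P _).
    apply/seteqP; split => w.
      by rewrite /xsection/= inE => At j; have [] := At j I.
    move=> h; rewrite /xsection/= inE => j _; split => /=; last exact: h.
    by split => //=; rewrite in_itv.
  rewrite (_ : xsection A t = set0) ?measure0//.
  apply/seteqP; split => w //; rewrite /xsection/= inE => At.
  by have [[]] := At 0%N I; rewrite /= in_itv/= (negbTE tT).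
(* The sections at fixed times are [P]-null, so the double integral is zero and almost every section
   at a fixed path is Lebesgue null. *)
have := @indic_fubini_tonelli _ _ _ _ R (@lebesgue_measure R) P A mA.
rewrite indic_fubini_tonelli_FE// indic_fubini_tonelli_GE//.
rewrite integral0_eq => [/esym G0|t _]; last exact: Ax.
have mGy : measurable_fun setT (@lebesgue_measure R \o ysection A).
  exact: measurable_fun_ysection.
have : ae_eq P setT (@lebesgue_measure R \o ysection A) (cst 0%E).
  apply/(ae_eq_integral_abs P measurableT mGy); rewrite -[RHS]G0.
  by apply: eq_integral => w _; rewrite gee0_abs.
apply: filterS => w /(_ I) /= hw; rewrite -AE; split => //.
exact: measurable_ysection.
Qed.

(** * The pathwise integral and the contradiction *)

(** The extreme value theorem bounds the set of values, which makes [sup] a genuine upper bound. *)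
Lemma le_running_max (R : realType) (T : R) (b : R -> R) (s t : R) :
  {within `[0, T], continuous b} -> 0 <= s <= t -> t <= T ->
  b s <= running_max b t.
Proof.
move=> cb /andP[s0 st] tT.
have T0 : 0 <= T by lra.
have [c _ cmax] := EVT_max T0 cb.
apply: ub_le_sup; last by exists s => //=; rewrite in_itv/= s0.
exists (b c) => _ [u /= + <-]; rewrite in_itv/= => /andP[u0 ut].
by apply: cmax; rewrite in_itv/= u0 (le_trans ut).
Qed.

Lemma gLS_integral_record_eq0 (R : realType) (T : R) (b : R -> R) (I : R) :
  {within `[0, T], continuous b} ->
  measurable (past_records T b : set (measurableTypeR R)) ->
  lebesgue_measure (past_records T b) = 0%E ->
  is_gLS_integral T (\1_[set t | b t = running_max b t]) b I -> I = 0.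
Proof.
move=> cb mN N0 [beta [_ _ _ ->]].
set f := \1_ _.
(* The point 0 is added because the path always equals its running maximum there. *)
pose Z : set (measurableTypeR R) := past_records T b `|` [set 0].
have m0 : measurable ([set 0] : set (measurableTypeR R)).
  exact: (@measurable_set1 R 0).
have mZ : measurable Z by exact: measurableU.
have Z0 : lebesgue_measure Z = 0%E.
  by rewrite measureU0//; exact: lebesgue_measure_set1.
have f0 x : 0 <= x <= T -> ~ Z x -> f x = 0.
  move=> /andP[x0 xT] nZ; rewrite /f indicE memNset//= => bx; apply: nZ.
  have [->|x_neq0] := eqVneq x 0; first by right.
  have x_gt0 : 0 < x by rewrite lt_def x_neq0.
  left; split => [|j]; first by rewrite x_gt0.
  rewrite bx; apply: le_running_max cb _ xT.
  have : 0 <= x / j.+1%:R <= x.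
    by rewrite divr_ge0//= ler_pdivrMr// ler_peMr// ler1n.
  by move: (x / _) => y /andP[? ?]; apply/andP; split; lra.
apply: (Rintegral_null _ mZ Z0); first exact: measurable_itv.
move=> x /=; rewrite in_itv/= => x_itv nZ; rewrite /weyl_left f0//.
(* Off [Z] the boundary term of the left derivative is zero, and its inner integrand vanishes off
   [Z] too. *)
rewrite (Rintegral_null _ mZ Z0); first by rewrite mul0r mulr0 addr0 mulr0 !mul0r.
  exact: measurable_itv.
move=> y /=; rewrite in_itv/= => /andP[y0 yx] nZy; rewrite f0// ?subrr ?mul0r//.
by rewrite y0 (le_trans yx)//; case/andP: x_itv.
Qed.

(** Here [E |X| = - E X = 0], so [X] and its square vanish almost surely. *)
Lemma has_mean_ae_eq0 (d : measure_display) (Omega : measurableType d)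
    (R : realType) (P : probability Omega R) (X : Omega -> R) :
  has_mean P X 0 -> {ae P, forall w, X w <= 0} ->
  has_mean P (fun w => X w ^+ 2) 0.
Proof.
move=> [IX EX] X_le0.
have mX := measurable_int _ IX.
have mX' : measurable_fun setT X by exact/measurable_EFinP.
have absX : (\int[P]_w `|(X w)%:E| = 0)%E.
  transitivity (\int[P]_w (- (X w)%:E))%E.
    apply: ae_eq_integral => //.
    - exact: measurableT_comp.
    - exact: measurableT_comp.
    - by apply: filterS X_le0 => w Xw _; rewrite lee0_abs.
  by rewrite integralN ?EX ?oppe0//; exact: integrable_add_def.
have X0 := (ae_eq_integral_abs P measurableT mX).1 absX.
have mX2 : measurable_fun setT (fun w => (X w ^+ 2)%:E).
  by apply/measurable_EFinP; exact: measurable_funX.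
have X20 : (\int[P]_w (X w ^+ 2)%:E = 0)%E.
  rewrite (@ae_eq_integral _ _ _ P setT (cst 0%E)) ?integral0//.
  apply: filterS X0 => w /(_ I) /= Xw _ /=.
  by rewrite (EFin_inj Xw) expr0n.
split => //; apply/integrableP; split => //.
under eq_integral do rewrite /= ger0_norm ?sqr_ge0//.
by rewrite X20 ltry.
Qed.

Theorem corollary3p2 (R : realType) (d : measure_display)
    (Omega : measurableType d) (P : probability Omega R)
    (T H : R) (B : R -> {RV P >-> R})
    (T_gt0 : 0 < T) (H_range : 2^-1 < H < 1)
    (fbmB : fractional_brownian_motion T H B) :
  ~ {ae P, forall w : Omega,
       exists2 I : R,
         is_gLS_integral T
           (\1_[set t | path_of B w t = running_max (path_of B w) t])
           (path_of B w) I &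
         running_max (path_of B w) T = B 0 w + I}.
Proof.
move=> rep.
have TT : T \in `[0, T] by rewrite in_itv/= lexx ltW.
have BT_le0 : {ae P, forall w, B T w <= 0}.
  apply: filterS2 (ae_null_past_records H_range fbmB) rep => w [mN N0] [I gI].
  have cb := @fbm_continuous _ _ _ _ _ _ _ fbmB w.
  rewrite (gLS_integral_record_eq0 cb mN N0 gI) (fbm_start fbmB) addr0 => <-.
  by apply: (le_running_max cb) => //; rewrite lexx ltW.
have BT2 := has_mean_ae_eq0 (fbm_has_mean0 fbmB TT) BT_le0.
have BT2' := fbm_has_cov fbmB TT TT.
(* The second moment of [B T] would be both 0 and [T^(2H) > 0]. *)
have := has_mean_uniq BT2 BT2'.
rewrite fbm_cov_diag; last by rewrite gt_eqF//; case/andP: H_range; lra.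
by move/eqP; rewrite eq_sym gt_eqF// powR_gt0.
Qed.
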